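(* Let $\langle p_n\mid n\in\mathbb{N}\rangle$ be the increasing sequence of all prime numbers and, for $\delta>0$, let $E_\delta=\langle p_n^\delta\mid n\in\mathbb{N}\rangle$. Then: (1) if the Riemann hypothesis holds, then $E_\delta$ is dense-expandable for every $0<\delta<1/2$; (2) if $\lim_{n\to\infty}(\sqrt{p_{n+1}}-\sqrt{p_n})=0$, then $E_\delta$ is dense-expandable for every $0<\delta\leq 1/2$.
   Context: A sequence $\langle A(n)\mid n\in\mathbb{N}\rangle$ of positive reals is dense-expandable if the set $\{\sum_{n\in S}\varepsilon_n A(n) : S \text{ a finite subset of } \mathbb{N},\ \varepsilon_n\in\{-1,1\}\}$ is dense in $\mathbb{R}$. *)

(* Defs.v *)
From mathcomp Require Export all_boot all_order all_algebra complex finmap.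
From mathcomp Require Export all_classical all_reals all_analysis.
Export numFieldNormedType.Exports.

Set Implicit Arguments.
Unset Strict Implicit.
Unset Printing Implicit Defensive.

Import Order.TTheory GRing.Theory Num.Theory.
Local Open Scope classical_set_scope.
Local Open Scope complex_scope.
Local Open Scope ring_scope.

Definition signed_finite_sums (R : realType) (A : nat -> R) : set R :=
  [set x | exists (S : {fset nat}) (eps : nat -> R),
    (forall n, n \in S -> eps n = -1 \/ eps n = 1) /\
    x = \sum_(n <- S) eps n * A n].

Definition dense_expandable (R : realType) (A : nat -> R) : Prop :=
  dense (signed_finite_sums A).

(* The carrier [R[i]^o] is the field of complex numbers seen as a normed module
   over itself, so that [derivable f z 1] below is complex differentiability. *)

Definition cexp (R : realType) (z : R[i]) : R[i] :=
  (expR (complex.Re z) * cos (complex.Im z))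
    +i* (expR (complex.Re z) * sin (complex.Im z)).

(* n^(-s) = exp (- s log n), meant for n >= 1. *)
Definition dirichlet_term (R : realType) (s : R[i]) (n : nat) : R[i] :=
  cexp (- s * (ln (n%:R : R))%:C).

(* The analytic continuation to C \ {1} of the sum of n^(-s) over n >= 1; its
   value at the pole 1 is unconstrained. *)
Definition is_riemann_zeta (R : realType) (zeta : R[i]^o -> R[i]^o) : Prop :=
  (forall s : R[i]^o, s != 1 -> derivable zeta s 1) /\
  (forall s : R[i]^o, 1 < complex.Re s ->
     series (fun k => dirichlet_term s k.+1 : R[i]^o) @ \oo --> zeta s).

(* By the identity theorem zeta is uniquely determined away from 1; the trivial
   zeros are the negative even integers. *)
Definition riemann_hypothesis (R : realType) : Prop :=
  exists2 zeta : R[i]^o -> R[i]^o, is_riemann_zeta zeta &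
    forall s : R[i]^o, s != 1 -> zeta s = 0 ->
      (forall k : nat, s <> - (2 * k.+1)%:R) -> complex.Re s = 1 / 2.

(* Main.v *)
(* Put A n = p_n ^ delta and split the primes into consecutive pairs
   (p_2k, p_2k+1).  If for every e > 0 the differences A (2k+1) - A (2k) smaller
   than e have a divergent sum, a greedy choice of them approximates any real
   number within e.  For delta <= 1/2 this divergence comes from that of the sum
   of the reciprocals of the primes:
   with a = A (2k) and b = A (2k+1), the mean value theorem gives
   1 / p_2k+1 <= (b - a) / delta, while b - a >= e forces
   1 / p_2k+1 <= (1/a - 1/b) / e, whose sum telescopes; so the reciprocals of
   the primes would have a finite sum if the small differences did. *)
Require Import Defs.
From mathcomp Require Import ring lra zify.
Import Order.TTheory GRing.Theory Num.Theory.
Local Open Scope classical_set_scope.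
Local Open Scope ring_scope.

(** Taking both members of a pair with opposite signs turns a signed sum over indices into a sum of
    pair differences, all with the common sign [c]. *)
Lemma big_filter_pairs (R : realType) (A : nat -> R) (c : R) (P : pred nat)
    (K : nat) :
  \sum_(n <- [fset n in iota 0 K.*2 | P n./2]%fset)
     (if odd n then c else - c) * A n =
  c * \sum_(0 <= k < K | P k) (A k.*2.+1 - A k.*2).
Proof.
rewrite big_fset /= undup_id ?iota_uniq//.
rewrite -[X in iota _ X]subn0 -/(index_iota 0 _).
elim: K => [|K IHK]; first by rewrite !big_nil mulr0.
rewrite doubleS big_mkcond !big_nat_recr //= -big_mkcond IHK.
rewrite [in RHS]big_mkcond big_nat_recr //= -big_mkcond /=.
rewrite uphalf_double doubleK odd_double /=.
by case: (P K); ring.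
Qed.

Lemma dense_expandable_of_small_pairs (R : realType) (A : nat -> R) :
  (forall k, A k.*2 <= A k.*2.+1) ->
  (forall e, 0 < e -> forall M, exists K,
     M < \sum_(0 <= k < K | A k.*2.+1 - A k.*2 < e) (A k.*2.+1 - A k.*2)) ->
  dense_expandable A.
Proof.
move=> Amono Asum O [x Ox] oO.
have /nbhs_ballP[e /= e0 xeO] : nbhs x O by exact: open_nbhs_nbhs.
pose s K := \sum_(0 <= k < K | A k.*2.+1 - A k.*2 < e) (A k.*2.+1 - A k.*2).
have exK : exists K, `|x| < s K by exact: Asum.
(* At the first [K.+1] whose partial sum exceeds [|x|], the last step added less than [e], so [s K]
   is within [e] of [|x|]. *)
case: (ex_minnP exK) => -[|K]; first by rewrite /s big_nil normr_lt0.
move=> xsK minK.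
have sKx : s K <= `|x|.
  by rewrite leNgt; apply/negP => /minK; rewrite ltnn.
have sKe : s K.+1 < s K + e.
  rewrite /s big_mkcond big_nat_recr //= -big_mkcond /= ltrD2l.
  by case: ifP.
exists (Num.sg x * s K); split.
  apply: xeO; rewrite /ball /= {1}[x]numEsg -mulrBr normrM.
  apply: (@le_lt_trans _ _ `| `|x| - s K|).
    by rewrite ler_piMl// normr_sg; case: eqP.
  rewrite ger0_norm ?subr_ge0//; lra.
(* [Num.sg 0] is 0, which is not an admissible sign. At [x = 0] either sign serves, since
   [0 <= s K <= |x|] forces [s K = 0]. *)
pose c : R := if x < 0 then -1 else 1.
have c1 : c = -1 \/ c = 1 by rewrite /c; case: ifP; [left|right].
have -> : Num.sg x * s K = c * s K.
  have [x0|x0] := eqVneq x 0; last by rewrite /c sgr_def x0 mulr1n; case: ltP.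
  suff -> : s K = 0 by rewrite !mulr0.
  apply/eqP; rewrite eq_le; apply/andP; split.
    by move: sKx; rewrite x0 normr0.
  by apply: sumr_ge0 => k _; rewrite subr_ge0.
exists [fset n in iota 0 K.*2 | A n./2.*2.+1 - A n./2.*2 < e]%fset,
  (fun n => if odd n then c else - c); split.
  by move=> n _; case: c1 => ->; case: ifP; rewrite ?opprK; [left|right|right|left].
by rewrite (big_filter_pairs R A c (fun k => A k.*2.+1 - A k.*2 < e)).
Qed.

(* Sieving by q: a rho-smooth n is either prime to q, hence pi-smooth, or q
   times a smaller rho-smooth number.  Iterating gives the Euler product bound
   on the harmonic sum without multiplying out the product. *)
Lemma smooth_harmonic_step (R : realType) (pi rho : nat_pred) (q N : nat) :
  prime q ->
  (forall l, prime l -> l \in rho -> l != q -> l \in pi) ->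
  \sum_(1 <= n < N.+1 | rho.-nat n) (n%:R^-1 : R) <=
  \sum_(1 <= n < N.+1 | pi.-nat n) n%:R^-1 +
  q%:R^-1 * \sum_(1 <= n < N.+1 | rho.-nat n) n%:R^-1.
Proof.
move=> q_pr rho_pi; rewrite [leLHS](bigID (fun n => q %| n)%N) /= addrC lerD//.
  rewrite big_mkcond [leRHS]big_mkcond /=; apply: ler_sum_nat => n /andP[n0 _].
  case: ifP => [/andP[rn qn]|_]; last by case: ifP.
  suff -> : pi.-nat n by [].
  apply/pnatP => // l l_pr ln; apply: rho_pi => //.
    by move/pnatP: rn; apply.
  by apply: contraNneq qn => <-.
have le_div : \sum_(1 <= n < N.+1 | rho.-nat n && (q %| n)%N) (n%:R^-1 : R) <=
    q%:R^-1 * \sum_(1 <= n < (N %/ q).+1 | rho.-nat n) n%:R^-1.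
  elim: N => [|N IHN]; first by rewrite div0n !big_nil mulr0.
  rewrite big_mkcond big_nat_recr //= -big_mkcond /= divnS ?prime_gt0//.
  case: ifP => [/andP[rN qN]|_].
    rewrite qN add1n [in leRHS]big_mkcond big_nat_recr //= -big_mkcond /=.
    rewrite mulrDr lerD//.
    have NE : N.+1 = (q * (N %/ q).+1)%N.
      by rewrite -{1}(divnK qN) mulnC divnS ?prime_gt0// qN.
    have -> : rho.-nat (N %/ q).+1.
      by move: rN; rewrite {1}NE pnatM => /andP[].
    by rewrite {1}NE natrM invfM.
  rewrite addr0; apply: le_trans IHN _.
  rewrite ler_wpM2l ?invr_ge0//.
  by apply: nondecreasing_series => //; case: (q %| _)%N => //; rewrite ltnS leq_addl.
apply: le_trans le_div _; rewrite ler_wpM2l ?invr_ge0//.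
by apply: nondecreasing_series => //; rewrite ltnS leq_div.
Qed.

(** Euler's argument: sieving by one prime at a time bounds the harmonic sums by the exponential of
    twice the sum of reciprocals of primes, so a bound on the latter would make the harmonic series
    converge. *)
Lemma sum_inv_primes_unbounded (R : realType) (p : nat -> nat) :
  (forall m n : nat, (m < n)%N -> (p m < p n)%N) ->
  (forall q : nat, prime q <-> exists n : nat, p n = q) ->
  forall M : R, exists n, M < \sum_(0 <= i < n) (p i)%:R^-1.
Proof.
move=> p_incr p_enum M; apply: contrapT => /forallNP bounded.
have p_pr i : prime (p i) by apply/p_enum; exists i.
have le_p i : (i <= p i)%N.
  by elim: i => // i IHi; apply: leq_ltn_trans IHi _; exact: p_incr.
pose pi k : nat_pred := [pred l | l \in [seq p i | i <- iota 0 k]].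
have smooth_le N k : \sum_(1 <= n < N.+1 | (pi k).-nat n) (n%:R^-1 : R) <=
    expR (2 * \sum_(0 <= i < k) (p i)%:R^-1).
  elim: k => [|k IHk].
    rewrite [in leRHS]big_nil mulr0 expR0.
    case: N => [|N]; first by rewrite big_nil.
    rewrite big_ltn_cond//= big_nat_cond big1 ?addr0 ?invr1//.
    move=> n /andP[/andP[n1 _] /pnatP]; rewrite (ltnW n1) => /(_ isT).
    by move/(_ _ (pdiv_prime n1) (pdiv_dvd n)).
  rewrite big_nat_recr//= mulrDr expRD.
  have step := @smooth_harmonic_step R (pi k) (pi k.+1) (p k) N (p_pr k).
  have {step} := step _; set S := \sum_(_ <= _ < _ | _) _ => step.
  have {step} : S <= expR (2 * \sum_(0 <= i < k) (p i)%:R^-1) + (p k)%:R^-1 * S.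
    apply: le_trans (lerD IHk (lexx _)); apply: step => l _.
    move=> lk; have /mapP[j jk ->] : l \in [seq p i | i <- iota 0 k.+1] := lk.
    move=> pj; apply/mapP; exists j => //.
    move: jk; rewrite !mem_iota /= !add0n ltnS leq_eqVlt => /predU1P[jk|//].
    by rewrite jk eqxx in pj.
  set E := expR _; set y := (p k)%:R^-1 => SE.
  have y2 : y <= 1 / 2.
    by rewrite /y mul1r lef_pV2 ?posrE ?ltr0n ?prime_gt0// ler_nat prime_gt1.
  have y0 : 0 < y by rewrite invr_gt0 ltr0n prime_gt0.
  have E0 : 0 < E := expR_gt0 _.
  (* For [0 < y <= 1/2], [1 / (1 - y) <= 1 + 2 * y <= expR (2 * y)]; this is the source of the
     factor 2. *)
  have : E * (1 + 2 * y) <= E * expR (2 * y).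
    by rewrite ler_wpM2l ?expR_ge1Dx// ltW.
  apply: le_trans.
  have : S * (1 - y) <= E * (1 + 2 * y) * (1 - y).
    have : 0 <= E * (y * (1 - 2 * y)).
      by rewrite mulr_ge0 ?(ltW E0)// mulr_ge0 ?(ltW y0)//; lra.
    nra.
  by rewrite ler_pM2r//; lra.
apply: (@dvg_harmonic R); apply: nondecreasing_is_cvgn.
  by apply: nondecreasing_series => n _ _; exact: harmonic_ge0.
exists (expR (2 * M)) => _ [N _ <-].
apply: (@le_trans _ _ (expR (2 * \sum_(0 <= i < N.+1) (p i)%:R^-1))); last first.
  by rewrite ler_expR ler_pM2l// leNgt; apply/negP; exact: bounded.
apply: le_trans (smooth_le N N.+1).
rewrite /series /= big_add1 /= [leRHS]big_mkcond /=.
apply: ler_sum_nat => n /andP[_ nN].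
(* A prime factor [p j] of [n.+1 <= N] has index [j <= p j <= N], so it is among the first [N.+1]
   primes. *)
suff -> : (pi N.+1).-nat n.+1 by [].
apply/pnatP => // l l_pr ln; apply/mapP.
have [j pj] := (p_enum l).1 l_pr; exists j => //.
rewrite mem_iota /= add0n ltnS (leq_trans (le_p j))// pj.
exact: leq_trans (dvdn_leq _ ln) nN.
Qed.

(** From [ln (a / b) <= a / b - 1] and [a + 1 <= b] comes [ln b - ln a >= 1 / b]; then [b^d = a^d *
    exp (d * (ln b - ln a)) >= a^d * (1 + d / b)], and [a^d >= 1]. *)
Lemma powR_sub_ge (R : realType) (a b d : R) :
  1 <= a -> a + 1 <= b -> 0 <= d -> d / b <= b `^ d - a `^ d.
Proof.
move=> a1 ab d0.
have a0 : 0 < a by lra.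
have b0 : 0 < b by lra.
have ln_ge : b^-1 <= ln b - ln a.
  have := @le_ln1Dx R (a / b - 1); rewrite addrCA subrr addr0.
  rewrite ln_div ?posrE// => H.
  have ab0 : 0 < a / b by rewrite divr_gt0.
  have : (a + 1) / b <= 1 by rewrite ler_pdivrMr// mul1r.
  by rewrite mulrDl mul1r; have := H ltac:(lra); lra.
have ad1 : 1 <= a `^ d by rewrite -(powRr0 a) ler_powR.
have bE : b `^ d = a `^ d * expR (d * (ln b - ln a)).
  by rewrite /powR !gt_eqF// -expRD; congr expR; ring.
rewrite bE; have := expR_ge1Dx (d * (ln b - ln a)).
have : d / b <= d * (ln b - ln a) by rewrite ler_wpM2l.
have : 0 <= d / b by rewrite divr_ge0// ltW.
by nra.
Qed.

Lemma primes_powR_dense_expandable (R : realType) (p : nat -> nat) (d : R) :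
  (forall m n : nat, (m < n)%N -> (p m < p n)%N) ->
  (forall q : nat, prime q <-> exists n : nat, p n = q) ->
  0 < d <= 1 / 2 -> dense_expandable (fun n => (p n)%:R `^ d).
Proof.
move=> p_incr p_enum /andP[d0 d2].
have p_gt0 i : (0 < p i)%N by rewrite prime_gt0//; apply/p_enum; exists i.
have p_ge1 i : 1 <= (p i)%:R :> R by rewrite ler1n.
pose A n : R := (p n)%:R `^ d.
have A_ge1 n : 1 <= A n by rewrite -(powRr0 (p n)%:R) ler_powR// ltW.
have A_le n : A n <= A n.+1.
  by rewrite ge0_ler_powR ?nnegrE ?ler_nat ?(ltW d0)// ltnW// p_incr.
apply: dense_expandable_of_small_pairs => [k|e e0 M]; first exact: A_le.
apply: contrapT => /forallNP bounded.
(* The small gaps contribute at most [M / d] to the sum of the [u k], the large ones at most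
   [1 / e]. The first prime adds at most 1, and each later pair [p (2k+1)], [p (2k+2)] at most
   [2 * u k], whence [1 + 2 * D]. *)
pose D := M / d + e^-1.
have [n] := sum_inv_primes_unbounded R p p_incr p_enum (1 + 2 * D).
pose u k : R := (p k.*2.+1)%:R^-1.
(* A large gap b - a >= e is paid for by the telescoping term
   (1/a - 1/b) / e >= 1 / (a b) >= 1 / b^2; this is where d <= 1/2 is used. *)
have u_le k :
    u k <= (if A k.*2.+1 - A k.*2 < e then A k.*2.+1 - A k.*2 else 0) / d +
      e^-1 * ((A k.*2)^-1 - (A k.*2.+1)^-1).
  set a := A k.*2; set b := A k.*2.+1.
  have a1 : 1 <= a := A_ge1 _.
  have b1 : 1 <= b := A_ge1 _.
  have ab : a <= b := A_le _.
  have inv_ab : a^-1 - b^-1 = (b - a) / (a * b) by field; apply/andP; split; lra.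
  have ab0 : 0 <= (a * b)^-1 by rewrite invr_ge0 mulr_ge0//; lra.
  case: ltP => small.
    apply: (@le_trans _ _ ((b - a) / d)).
      rewrite ler_pdivlMr// mulrC; apply: powR_sub_ge => //; last exact: ltW.
      by rewrite natr1 ler_nat p_incr.
    by rewrite lerDl mulr_ge0 ?invr_ge0 ?(ltW e0)// inv_ab mulr_ge0 ?subr_ge0.
  rewrite mul0r add0r inv_ab mulrA; apply: (@le_trans _ _ (a * b)^-1).
    rewrite /u lef_pV2 ?posrE ?ltr0n ?mulr_gt0//; [|lra|lra].
    apply: (@le_trans _ _ (b * b)); first by rewrite ler_wpM2r//; lra.
    rewrite /b /A -powRD; last by rewrite [_%:R == _]gt_eqF ?implybT ?ltr0n.
    by rewrite -[leRHS]powRr1// ler_powR//; lra.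
  by rewrite ler_peMl// mulrC ler_pdivlMr// mul1r.
have u_sum K : \sum_(0 <= k < K) u k <= D.
  apply: le_trans (ler_sum_nat (fun k _ => u_le k)) _.
  rewrite big_split /= -mulr_suml -mulr_sumr -big_mkcond /= lerD//.
    by rewrite ler_pM2r ?invr_gt0// leNgt; apply/negP; exact: bounded.
  rewrite -[leRHS]mulr1 ler_pM2l ?invr_gt0//.
  apply: (@le_trans _ _ ((A 0)^-1 - (A K.*2)^-1)); last first.
    have : 0 <= (A K.*2)^-1 by rewrite invr_ge0 (le_trans _ (A_ge1 _)).
    by have := invf_le1 (lt_le_trans ltr01 (A_ge1 0%N)); rewrite A_ge1; lra.
  elim: K => [|K IHK]; first by rewrite big_nil subrr.
  rewrite big_nat_recr//= doubleS.
  (* The sum skips the gaps between consecutive pairs, so it telescopes only up to this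
     inequality. *)
  have : (A K.*2.+2)^-1 <= (A K.*2.+1)^-1.
    by rewrite lef_pV2 ?posrE ?(lt_le_trans ltr01 (A_ge1 _)).
  lra.
apply/negP; rewrite -leNgt.
apply: (@le_trans _ _ (\sum_(0 <= i < n.*2.+1) (p i)%:R^-1)).
  by apply: nondecreasing_series => //; lia.
apply: (@le_trans _ _ (1 + 2 * \sum_(0 <= k < n) u k)); last first.
  by have := u_sum n; lra.
elim: n => [|n IHn].
  by rewrite !big_nat1 big_nil mulr0 addr0 invf_le1// ltr0n.
rewrite doubleS [in leLHS]big_nat_recr//= [in leLHS]big_nat_recr//=.
rewrite [in leRHS]big_nat_recr//=.
have : ((p n.*2.+2)%:R^-1 : R) <= u n.
  by rewrite lef_pV2 ?posrE ?ltr0n// ler_nat ltnW// p_incr.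
by move: IHn; rewrite /u; lra.
Qed.

Theorem theorem6 (R : realType) (p : nat -> nat)
    (p_increasing : forall m n : nat, (m < n)%N -> (p m < p n)%N)
    (p_enum : forall q : nat, prime q <-> exists n : nat, p n = q) :
  (riemann_hypothesis R ->
     forall delta : R, 0 < delta < 1 / 2 ->
       dense_expandable (fun n => (p n)%:R `^ delta)) /\
  ((fun n => Num.sqrt ((p n.+1)%:R : R) - Num.sqrt ((p n)%:R : R)) @ \oo --> (0 : R) ->
     forall delta : R, 0 < delta <= 1 / 2 ->
       dense_expandable (fun n => (p n)%:R `^ delta)).
Proof.
split=> _ delta delta_bd; apply: primes_powR_dense_expandable => //.
by case/andP: delta_bd => -> /ltW ->.
Qed.
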